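(* Let $\Omega$ be a compact metric space, let $\mathbb{T}=\mathbb{Z}$ or $\mathbb{T}=\mathbb{R}$, and let $\Phi_t(x)=\omega_t(x)\odot\tau_t(x)$ be a flow on $\Omega$ with time $\mathbb{T}$, transversal action $\omega$ and translation function $\tau$ with respect to a flow $\varphi_t(x)=x\odot t$, preserving the order on the leaves of $\varphi$ (all as defined in the context). Suppose that the translation number $\rho(\Phi)$ exists and is $(\varphi,\omega)$-irrational. Then the cohomological equation $$\tau_t(x)\ =\ \gamma(x)-\gamma(\Phi_t(x))+t\rho(\Phi)\qquad \text{for all } x\in\Omega,\ t\in\mathbb{T}$$ has a continuous solution $\gamma:\Omega\to\mathbb{R}$ if and only if $\Phi$ has bounded mean motion. In this case, the map $h:\Omega\to\Omega$, $h(x)=x\odot\gamma(x)$, is a semiconjugacy from $\Phi$ to the translation flow $T^{\rho(\Phi)}$, that is, $h$ is continuous and onto and $h\circ\Phi_t=T^{\rho(\Phi)}_t\circ h$ for all $t\in\mathbb{T}$. Moreover, $h$ can be chosen to be order-preserving on the leaves, that is, the continuous solution $\gamma$ can be chosen such that $t+\gamma(x\odot t)\geq\gamma(x)$ for all $x\in\Omega$ and $t\geq 0$.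
   Context: Setting. $\varphi:\mathbb{R}\times\Omega\to\Omega$, $(t,x)\mapsto\varphi_t(x)=x\odot t$, is a continuous flow ($\mathbb{R}$-action) on the compact metric space $\Omega$. The leaf of $x$ is $\varphi_{\mathbb{R}}(x)=\{\varphi_t(x)\mid t\in\mathbb{R}\}$. $\omega:\mathbb{T}\times\Omega\to\Omega$, $(t,x)\mapsto\omega_t(x)$, is a continuous flow with time $\mathbb{T}$ commuting with $\varphi$: $\omega_s(x\odot t)=\omega_s(x)\odot t$ (the transversal action). $\tau:\mathbb{T}\times\Omega\to\mathbb{R}$, $(t,x)\mapsto\tau_t(x)$, is a continuous function (the translation function) with $$\tau_{s+t}(x)=\tau_s(\omega_t(x)\odot\tau_t(x))+\tau_t(x)\qquad (s,t\in\mathbb{T},\ x\in\Omega),$$ so that $\Phi_t(x)=\omega_t(x)\odot\tau_t(x)$ defines a flow on $\Omega$ with time $\mathbb{T}$. It is assumed that $\Phi$ preserves the order on leaves: $t+\tau_s(x\odot t)\geq\tau_s(x)$ for all $x\in\Omega$, $t\geq0$, $s\in\mathbb{T}$. Definitions. For $\rho\in\mathbb{R}$ the translation flow $T^\rho$ is $T^\rho_t(x)=\omega_t(x)\odot t\rho$, $t\in\mathbb{T}$. The number $\rho$ is $(\varphi,\omega)$-irrational if $T^\rho$ is minimal. If the limit $\rho(\Phi)=\lim_{t\to\infty}\tau_t(x)/t$ exists and is independent of $x\in\Omega$, it is called the translation number of $\Phi$. $\Phi$ has bounded mean motion if there is $C>0$ with $|\tau_t(x)-t\rho(\Phi)|\leq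 C$ for all $x\in\Omega$, $t\in\mathbb{T}$. *)

(* Defs.v *)
From HB Require Import structures.
From mathcomp Require Import all_boot all_order all_algebra.
From mathcomp Require Import all_classical all_reals all_analysis.

Set Implicit Arguments.
Unset Strict Implicit.
Unset Printing Implicit Defensive.

Import Order.TTheory GRing.Theory Num.Theory.
Import numFieldNormedType.Exports.

Local Open Scope classical_set_scope.
Local Open Scope ring_scope.

(* MathComp-Analysis puts no topology on int; the discrete one is used here. *)
HB.instance Definition _ := hasNbhs.Build int principal_filter.
HB.instance Definition _ := Discrete_ofNbhs.Build int erefl.

Fact int_add_continuous : continuous (fun x : int * int => x.1 + x.2).
Proof.
move=> [a b] /= A /principal_filterP Aab.
exists ([set a], [set b]); first by split=> /=; exact/principal_filterP.
by move=> [c d] /= [-> ->].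
Qed.

Fact int_opp_continuous : continuous (-%R : int -> int).
Proof.
move=> a A /principal_filterP Aa.
by apply/principal_filterP.
Qed.

HB.instance Definition _ :=
  PreTopologicalNmodule_isTopologicalNmodule.Build int int_add_continuous.
HB.instance Definition _ :=
  TopologicalNmodule_isTopologicalZmodule.Build int int_opp_continuous.


Variant time_kind := discrete_time | continuous_time.

Definition time (R : realType) (k : time_kind) : topologicalZmodType :=
  match k with discrete_time => int | continuous_time => R end.

Definition time_val (R : realType) (k : time_kind) : time R k -> R :=
  match k with
  | discrete_time => fun n : int => n%:~R
  | continuous_time => fun t : R => t
  end.

(* The filter of t --> +oo in the time group; for k := continuous_time it is
   pinfty_nbhs R. *)
Definition time_pinfty (R : realType) (k : time_kind) : set_system (time R k) :=
  fun A => exists M : R, forall t : time R k, M < time_val t -> A t.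

#[global] Instance time_pinfty_proper (R : realType) (k : time_kind) :
  ProperFilter (@time_pinfty R k).
Proof.
have pos (M : R) : exists t : time R k, M < time_val t.
  case: k => /=.
  - exists (Num.floor M + 1); exact: floorD1_gt.
  - by exists (M + 1); rewrite ltrDl.
split; first by move=> [M HM]; have [t /HM] := pos M.
split.
- by exists 0.
- move=> A B [M HA] [N HB]; exists (Num.max M N) => t.
  by rewrite gt_max => /andP[Mt Nt]; split; [exact: HA|exact: HB].
- by move=> A B AB [M HA]; exists M => t /HA /AB.
Qed.

Section flows.
Context {T : topologicalZmodType} {X : topologicalType}.
Implicit Types F G : T -> X -> X.

Definition is_flow F : Prop :=
  [/\ continuous (fun p : T * X => F p.1 p.2),
      forall x, F 0 x = x &
      forall s t x, F (s + t) x = F s (F t x)].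

Definition minimal_flow F : Prop :=
  forall x, dense [set F t x | t in [set: T]].

Definition semiconjugacy F G (h : X -> X) : Prop :=
  [/\ continuous h,
      (forall y, exists x, h x = y) &
      forall t x, h (F t x) = G t (h x)].

End flows.

Section translation.
Context {R : realType} {k : time_kind} {X : topologicalType}.
Local Notation T := (time R k).
Implicit Types (phi : R -> X -> X) (omega : T -> X -> X) (tau : T -> X -> R).

(* x \odot t is phi t x. *)

Definition commuting_flows phi omega : Prop :=
  forall s t x, omega s (phi t x) = phi t (omega s x).

Definition leaf_flow phi omega tau : T -> X -> X :=
  fun t x => phi (tau t x) (omega t x).

Definition translation_function phi omega tau : Prop :=
  continuous (fun p : T * X => tau p.1 p.2) /\
  forall s t x, tau (s + t) x = tau s (leaf_flow phi omega tau t x) + tau t x.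

Definition preserves_leaf_order phi tau : Prop :=
  forall x (t : R) s, 0 <= t -> tau s x <= t + tau s (phi t x).

Definition translation_flow phi omega (rho : R) : T -> X -> X :=
  fun t x => phi (time_val t * rho) (omega t x).

Definition irrational_for phi omega (rho : R) : Prop :=
  minimal_flow (translation_flow phi omega rho).

Definition translation_number tau (rho : R) : Prop :=
  forall x, tau t x / time_val t @[t --> @time_pinfty R k] --> rho.

Definition bounded_mean_motion tau (rho : R) : Prop :=
  exists2 C : R, 0 < C & forall x t, `|tau t x - time_val t * rho| <= C.

Definition cohomological_solution phi omega tau (rho : R) (gamma : X -> R) :
    Prop :=
  forall x t, tau t x =
    gamma x - gamma (leaf_flow phi omega tau t x) + time_val t * rho.

End translation.

(* Main.v *)
Require Import Defs.
From HB Require Import structures.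
From mathcomp Require Import all_boot all_order all_algebra.
From mathcomp Require Import all_classical all_reals all_analysis.
From mathcomp Require Import lra.

Set Implicit Arguments.
Unset Strict Implicit.
Unset Printing Implicit Defensive.

Import Order.TTheory GRing.Theory Num.Theory.
Import numFieldNormedType.Exports.

Local Open Scope classical_set_scope.
Local Open Scope ring_scope.

(* Writing points as phi s z, the flow Phi becomes a skew product over the
   minimal translation flow, with increasing fibre maps f_t(z, s) = s +
   tau_t(phi s z) - t rho. Under bounded mean motion the infimum of the
   images of the zero section is a bounded, upper semicontinuous invariant
   graph psi+; its lower semicontinuous envelope psi- is invariant too.
   Shifting by r along the leaves turns an invariant graph psi into the
   invariant graph z |-> psi (phi r z) + r. For r < s, minimality gives a
   dichotomy: either psi+ shifted by r lies strictly below psi- shifted by s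
   everywhere, or it nowhere does, and the latter contradicts boundedness.
   Thus the shifted graphs are strictly ordered, and gamma x = sup {r | psi-
   (phi r x) + r <= 0} is continuous: psi- controls it from above and psi+
   from below. *)

(** * Semicontinuous functions and lower semicontinuous envelopes *)

Section semicontinuity.
Context {R : realType} {X : topologicalType}.
Implicit Types f g : X -> R.

Definition lsc f := forall x a, a < f x -> \forall y \near x, a < f y.

Definition usc f := forall x a, f x < a -> \forall y \near x, f y < a.

Lemma lsc_cst (c : R) : lsc (fun=> c).
Proof. by move=> x a ac; near do exact: ac. Unshelve. all: by end_near. Qed.

Lemma lsc_comp f (u : X -> X) : continuous u -> lsc f -> lsc (f \o u).
Proof. by move=> cu lf x a /lf /cu. Qed.

Lemma usc_comp f (u : X -> X) : continuous u -> usc f -> usc (f \o u).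
Proof. by move=> cu lf x a /lf /cu. Qed.

(** Near [x] only lower bounds on [g] persist, so [F] is kept above [a] at a height slightly below
    [g x], and monotonicity lifts this to [g y]. *)
Lemma lsc_monotone_comp (F : X * R -> R) g :
  continuous F -> (forall x, {homo (fun s => F (x, s)) : a b / a <= b}) ->
  lsc g -> lsc (fun x => F (x, g x)).
Proof.
move=> cF F_mono lg x a aF.
have [[U V] /= [xU] /nbhs_ballP[e /= e0 eV] UV] := cvgr_gt _ (cF (x, g x)) _ aF.
have gV : V (g x - e / 2).
  by apply: eV; rewrite /ball /= opprB addrCA subrr addr0 gtr0_norm; lra.
have gx : g x - e / 2 < g x by lra.
near=> y; apply: lt_le_trans (UV (y, g x - e / 2) _) _ => /=.
  by split=> //=; near: y.
by apply/F_mono/ltW; near: y; exact: lg.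
Unshelve. all: by end_near. Qed.

(** One index that brings the infimum below [a] at [x] still does so nearby. The bound [c] keeps
    [inf] away from its default value. *)
Lemma usc_inf (I : Type) (F : I -> X -> R) (i0 : I) (c : R) :
  (forall i, continuous (F i)) -> (forall i x, c <= F i x) ->
  usc (fun x => inf [set F i x | i in [set: I]]).
Proof.
move=> cF lbF x a infa.
have [|_ [i _ <-] Fa] := inf_lt _ infa; first by exists (F i0 x), i0.
near=> y; have Fya : F i y < a by near: y; exact: cvgr_lt _ (cF i x) _ Fa.
apply: le_lt_trans Fya; apply: ge_inf; last by exists i.
by exists c => _ [j _ <-].
Unshelve. all: by end_near. Qed.

Definition lsc_minorant f (g : X -> R) := lsc g /\ forall x, g x <= f x.

Definition lsc_envelope f x := sup [set g x | g in lsc_minorant f].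

Lemma lsc_minorant_le f g x : lsc_minorant f g -> g x <= lsc_envelope f x.
Proof.
move=> fg; apply: ub_le_sup; last by exists g.
by exists (f x) => _ [h [_ hf] <-].
Qed.

(** The given minorant [g] ensures that the supremum is not taken over the empty set. *)
Lemma lsc_envelope_minorant f g :
  lsc_minorant f g -> lsc_minorant f (lsc_envelope f).
Proof.
move=> fg.
have nef x : [set h x | h in lsc_minorant f] !=set0 by exists (g x), g.
split=> x; last by apply: ge_sup => // _ [h [_ hf] <-].
move=> a; case/(sup_gt (nef x)) => _ [h fh <-] ah.
near=> y; apply: lt_le_trans (lsc_minorant_le y fh).
by near: y; exact: fh.1.
Unshelve. all: by end_near. Qed.

End semicontinuity.

Section flow_theory.
Context {T : topologicalZmodType} {X : topologicalType}.

Lemma flow_continuousr (F : T -> X -> X) t : is_flow F -> continuous (F t).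
Proof.
case=> cF _ _ x; apply: (@continuous_comp _ _ _ (pair t) (fun p => F p.1 p.2)).
  by apply: cvg_pair => /=; [exact: cvg_cst|exact: cvg_id].
exact: cF.
Qed.

End flow_theory.

Section time_theory.
Context {R : realType} {k : time_kind}.
Implicit Types s t : time R k.

Lemma time_valD s t : time_val (s + t) = time_val s + time_val t.
Proof. by case: k s t => //= s t; rewrite intrD. Qed.

Lemma time_val0 : time_val (0 : time R k) = 0.
Proof. by case: k. Qed.

End time_theory.

(** * The flow as a skew product over the translation flow *)

Section leaf_flow_theory.
Context {R : realType} {k : time_kind} {X : topologicalType}.
Variables (phi : R -> X -> X) (omega : time R k -> X -> X).
Variables (tau : time R k -> X -> R) (rho : R).
Hypotheses (flow_phi : is_flow phi) (flow_omega : is_flow omega).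
Hypothesis phi_omega : commuting_flows phi omega.
Hypothesis tau_translation : translation_function phi omega tau.

Local Notation Phi := (leaf_flow phi omega tau).
Local Notation Trho := (translation_flow phi omega rho).

Let phi0 x : phi 0 x = x. Proof. by case: flow_phi. Qed.
Let phiD s t x : phi (s + t) x = phi s (phi t x). Proof. by case: flow_phi. Qed.
Let omega0 x : omega 0 x = x. Proof. by case: flow_omega. Qed.
Let omegaD s t x : omega (s + t) x = omega s (omega t x).
Proof. by case: flow_omega. Qed.

Lemma phi_continuous : continuous (fun p : R * X => phi p.1 p.2).
Proof. by case: flow_phi. Qed.

Lemma tau_continuous t : continuous (tau t).
Proof.
move=> x; apply: (@continuous_comp _ _ _ (pair t) (fun p => tau p.1 p.2)).
  by apply: cvg_pair => /=; [exact: cvg_cst|exact: cvg_id].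
exact: tau_translation.1.
Qed.

Lemma translation_flow0 x : Trho 0 x = x.
Proof. by rewrite /translation_flow time_val0 mul0r phi0 omega0. Qed.

Lemma translation_flowD s t x : Trho (s + t) x = Trho s (Trho t x).
Proof.
by rewrite /translation_flow time_valD mulrDl phiD omegaD phi_omega.
Qed.

Lemma translation_flowK t x : Trho (- t) (Trho t x) = x.
Proof. by rewrite -translation_flowD addNr translation_flow0. Qed.

Lemma translation_flowKV t x : Trho t (Trho (- t) x) = x.
Proof. by rewrite -translation_flowD addrN translation_flow0. Qed.

Lemma translation_flow_phi t r x : Trho t (phi r x) = phi r (Trho t x).
Proof. by rewrite /translation_flow phi_omega -!phiD addrC. Qed.

Lemma translation_flow_continuous t : continuous (Trho t).
Proof.
move=> x; apply: (@continuous_comp _ _ _ (omega t) (phi (time_val t * rho))).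
  exact: (flow_continuousr flow_omega).
exact: (flow_continuousr flow_phi).
Qed.

(* The flow [Phi] read in the coordinates [(z, s)] standing for the point
   [phi s z]: it becomes a skew product over the translation flow, with fibre
   maps [fibre_map t z]. *)
Definition fibre_map (t : time R k) (z : X) (s : R) : R :=
  s + tau t (phi s z) - time_val t * rho.

Lemma phi_fibre_map t z s : phi (fibre_map t z s) (Trho t z) = Phi t (phi s z).
Proof.
by rewrite /leaf_flow phi_omega /translation_flow -!phiD /fibre_map subrK addrC.
Qed.

(** The cocycle equation of [tau] at the point [phi a z]. *)
Lemma fibre_mapD s t z a :
  fibre_map (s + t) z a = fibre_map s (Trho t z) (fibre_map t z a).
Proof.
rewrite {2}/fibre_map phi_fibre_map /fibre_map time_valD mulrDl.
rewrite tau_translation.2.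
lra.
Qed.

Lemma fibre_map_continuous t :
  continuous (fun p : X * R => fibre_map t p.1 p.2).
Proof.
move=> p; apply: cvgB; last exact: cvg_cst.
apply: cvgD; first exact: cvg_snd.
apply: (@continuous_comp _ _ _ (fun q : X * R => phi q.2 q.1) (tau t)).
  apply: (@continuous_comp _ _ _ (fun q : X * R => (q.2, q.1))
      (fun q : R * X => phi q.1 q.2)).
    by move: p => [x s]; exact: cvg_pair cvg_snd cvg_fst.
  exact: phi_continuous.
exact: tau_continuous.
Qed.

(** The coordinates [(phi r z, s)] and [(z, s + r)] name the same point of the leaf. *)
Lemma fibre_map_phi t z r s :
  fibre_map t (phi r z) s + r = fibre_map t z (s + r).
Proof. by rewrite /fibre_map phiD; lra. Qed.

(** Both sides move [omega t x] along its leaf, and the cohomological equation says that the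
    displacements agree. *)
Lemma cohomological_semiconj gamma :
  cohomological_solution phi omega tau rho gamma ->
  forall t x, phi (gamma (Phi t x)) (Phi t x) = Trho t (phi (gamma x) x).
Proof.
move=> gammaE t x.
rewrite /translation_flow phi_omega [X in phi _ X = _]/leaf_flow -!phiD.
by congr phi; rewrite (gammaE x t); lra.
Qed.

(** * Order-preserving, invertible fibre maps *)

Section bounded_mean_motion.
Variable C : R.
Hypothesis order_Phi : preserves_leaf_order phi tau.
Hypothesis tau_bounded : forall x t, `|tau t x - time_val t * rho| <= C.

(* The cocycle equation only gives that [Phi 0] is idempotent; on a leaf it is
   also onto, by the intermediate value theorem. *)
Lemma tau0 x : tau 0 x = 0.
Proof.
have tau0C y : - C <= tau 0 y <= C.
  by move: (tau_bounded y 0); rewrite time_val0 mul0r subr0 ler_norml.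
have C0 : 0 <= C by have /andP[] := tau0C x; lra.
pose p s := s + tau 0 (phi s x).
have cp : continuous p.
  move=> s; apply: cvgD; first exact: cvg_id.
  apply: (@continuous_comp _ _ _ (phi^~ x) (tau 0)); last exact: tau_continuous.
  apply: (@continuous_comp _ _ _ (pair^~ x) (fun q => phi q.1 q.2)).
    apply: (cvg_pair (G := nbhs s) (H := nbhs x)); first exact: cvg_id.
    exact: cvg_cst.
  exact: phi_continuous.
(* Since [p] differs from the identity by at most [C], it changes sign on [[- C, C]]. *)
have [|||s _ ps0] := @IVT R p (- C) C 0.
- lra.
- exact: continuous_subspaceT.
- have /andP[? ?] := tau0C (phi (- C) x); have /andP[? ?] := tau0C (phi C x).
  by rewrite ge_min le_max /p; apply/andP; split; apply/orP; [left|right]; lra.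
(* As [Phi 0] sends [phi s x] to [x], the cocycle equation leaves [tau 0 x = 0] after
   cancellation. *)
have := tau_translation.2 0 0 (phi s x).
rewrite addr0 -[X in X = _]add0r => /addIr.
by rewrite /leaf_flow omega0 -phiD [_ + s]addrC -/(p s) ps0 phi0.
Qed.

Lemma fibre_map0 z s : fibre_map 0 z s = s.
Proof. by rewrite /fibre_map tau0 time_val0 mul0r subr0 addr0. Qed.

Lemma fibre_map_mono t z : {homo fibre_map t z : a b / a <= b}.
Proof.
move=> a b ab; have /(_ _)/= := order_Phi (phi a z) t (t := b - a).
rewrite subr_ge0 => /(_ ab); rewrite -phiD subrK /fibre_map; lra.
Qed.

Lemma fibre_mapK t z s : fibre_map (- t) (Trho t z) (fibre_map t z s) = s.
Proof. by rewrite -fibre_mapD addNr fibre_map0. Qed.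

Lemma fibre_mapKV t z s :
  fibre_map t z (fibre_map (- t) (Trho t z) s) = s.
Proof.
by have := fibre_mapK (- t) (Trho t z) s; rewrite opprK translation_flowK.
Qed.

Lemma le_fibre_map t z a b : (fibre_map t z a <= fibre_map t z b) = (a <= b).
Proof.
apply/idP/idP; last exact: fibre_map_mono.
by move/(fibre_map_mono (- t) (Trho t z)); rewrite !fibre_mapK.
Qed.

(** * Invariant graphs of the skew product *)

Definition invariant_graph (psi : X -> R) :=
  forall t z, psi (Trho t z) = fibre_map t z (psi z).

(* As times form a group, one inequality suffices. *)
Lemma invariant_graph_ge psi :
  (forall t z, fibre_map t z (psi z) <= psi (Trho t z)) -> invariant_graph psi.
Proof.
move=> psi_ge t z; apply/le_anti; rewrite psi_ge andbT.
rewrite -[leLHS](fibre_mapKV t z) le_fibre_map.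
by have := psi_ge (- t) (Trho t z); rewrite translation_flowK.
Qed.

(** The graph psi+. Starting over [Trho (- t) z] makes the time-[t] image of the zero section lie
    over [z]. *)
Definition orbit_inf z :=
  inf [set fibre_map t (Trho (- t) z) 0 | t in [set: time R k]].

Lemma fibre_map_at0_bounds t z : - C <= fibre_map t z 0 <= C.
Proof. by rewrite /fibre_map phi0 add0r -ler_norml. Qed.

Lemma orbit_inf_le t z : orbit_inf z <= fibre_map t (Trho (- t) z) 0.
Proof.
apply: ge_inf; last by exists t.
by exists (- C) => _ [u _ <-];
  have /andP[] := fibre_map_at0_bounds u (Trho (- u) z).
Qed.

Lemma orbit_inf_geP z a :
  (forall t, a <= fibre_map t (Trho (- t) z) 0) -> a <= orbit_inf z.
Proof.
move=> az; apply: lb_le_inf; first by exists (fibre_map 0 (Trho (- 0) z) 0), 0.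
by move=> _ [t _ <-].
Qed.

Lemma orbit_inf_bounds z : - C <= orbit_inf z <= C.
Proof.
apply/andP; split.
  by apply: orbit_inf_geP => t;
    have /andP[] := fibre_map_at0_bounds t (Trho (- t) z).
apply: le_trans (orbit_inf_le 0 z) _.
by have /andP[] := fibre_map_at0_bounds 0 (Trho (- 0) z).
Qed.

Lemma usc_orbit_inf : usc orbit_inf.
Proof.
apply: (usc_inf 0 (c := - C)) => [t x|t x]; last first.
  by have /andP[] := fibre_map_at0_bounds t (Trho (- t) x).
apply: (@continuous_comp _ _ _ (fun y => (Trho (- t) y, 0))
  (fun p => fibre_map t p.1 p.2)); last exact: fibre_map_continuous.
apply: (cvg_pair (G := nbhs (Trho (- t) x)) (H := nbhs (0 : R))).
  exact: translation_flow_continuous.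
exact: cvg_cst.
Qed.

(** The time-[u] image of the zero section over [Trho t z] is the time-[t] image of its
    time-[(u - t)] image over [z]. *)
Lemma orbit_inf_invariant : invariant_graph orbit_inf.
Proof.
apply: invariant_graph_ge => t z; apply: orbit_inf_geP => u.
rewrite -translation_flowD [- u + t]addrC -opprB.
rewrite -[X in _ <= fibre_map X _ _](subrKC t u) fibre_mapD translation_flowKV.
rewrite le_fibre_map.
exact: orbit_inf_le.
Qed.

(** The graph psi-. *)
Definition lower_graph := lsc_envelope orbit_inf.

Lemma lower_graph_minorant : lsc_minorant orbit_inf lower_graph.
Proof.
apply: (lsc_envelope_minorant (g := fun=> - C)); split; first exact: lsc_cst.
by move=> z; have /andP[] := orbit_inf_bounds z.
Qed.

Lemma lsc_lower_graph : lsc lower_graph.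
Proof. exact: lower_graph_minorant.1. Qed.

Lemma lower_graph_le z : lower_graph z <= orbit_inf z.
Proof. exact: lower_graph_minorant.2. Qed.

Lemma lower_graph_bounds z : - C <= lower_graph z <= C.
Proof.
have /andP[infC Cinf] := orbit_inf_bounds z.
rewrite (le_trans (lower_graph_le z) Cinf) andbT.
apply: (lsc_minorant_le (g := fun=> - C)); split; first exact: lsc_cst.
by move=> y; have /andP[] := orbit_inf_bounds y.
Qed.

(** The time-[t] image of the lower graph is again a lower semicontinuous minorant of [orbit_inf],
    so it lies below the envelope. *)
Lemma lower_graph_invariant : invariant_graph lower_graph.
Proof.
apply: invariant_graph_ge => t z.
rewrite -[in leLHS](translation_flowK t z).
apply: (lsc_minorant_le
  (g := fun y => fibre_map t (Trho (- t) y) (lower_graph (Trho (- t) y)))).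
split=> [|y]; last first.
  rewrite -[leRHS](congr1 _ (translation_flowKV t y)) orbit_inf_invariant.
  by rewrite le_fibre_map lower_graph_le.
apply: (lsc_comp (translation_flow_continuous (t := - t))
  (f := fun y => fibre_map t y (lower_graph y))).
apply: (lsc_monotone_comp (F := fun p => fibre_map t p.1 p.2)).
- exact: fibre_map_continuous.
- by move=> x a b; exact: fibre_map_mono.
- exact: lsc_lower_graph.
Qed.

(** The point of the graph of [psi] over [phi r z], written in the leaf coordinate based at [z]. *)
Definition shift_graph (psi : X -> R) r z := psi (phi r z) + r.

Lemma shift_graph_invariant psi r :
  invariant_graph psi -> invariant_graph (shift_graph psi r).
Proof.
move=> psi_inv t z.
by rewrite /shift_graph -translation_flow_phi psi_inv fibre_map_phi.
Qed.

Lemma lsc_shift_graph psi r : lsc psi -> lsc (shift_graph psi r).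
Proof.
move=> lpsi x a; rewrite /shift_graph -ltrBlDr => ax.
have := lsc_comp (flow_continuousr (t := r) flow_phi) lpsi ax.
by apply: filterS => y /=; rewrite ltrBlDr.
Qed.

Lemma usc_shift_graph psi r : usc psi -> usc (shift_graph psi r).
Proof.
move=> lpsi x a; rewrite /shift_graph -ltrBrDr => ax.
have := usc_comp (flow_continuousr (t := r) flow_phi) lpsi ax.
by apply: filterS => y /=; rewrite ltrBrDr.
Qed.

(** * Minimality and the strict order of shifted graphs *)

Hypothesis rho_irrational : irrational_for phi omega rho.

(** Semicontinuity spreads the strict inequality to an open set. The translation orbit of [x] enters
    it, and the monotone fibre maps carry the inequality back to [x]. *)
Lemma invariant_graph_lt f g : invariant_graph f -> invariant_graph g ->
  usc f -> lsc g -> forall z, f z < g z -> forall x, f x < g x.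
Proof.
move=> f_inv g_inv uf lg z fg x.
pose m := (f z + g z) / 2.
have fm : f z < m by rewrite /m; lra.
have mg : m < g z by rewrite /m; lra.
have Uz : \forall y \near z, f y < m < g y.
  by near=> y; apply/andP; split; near: y; [exact: uf|exact: lg].
move: Uz; rewrite -nbhs_nearE nbhsE => -[U [oU Uz] Ufg].
have [w [/Ufg /andP[fw gw] [t _ tw]]] :=
  rho_irrational x (ex_intro _ z Uz) oU.
move: (lt_trans fw gw); rewrite -tw f_inv g_inv.
by rewrite !ltNge le_fibre_map.
Unshelve. all: by end_near. Qed.

(* Otherwise the shifted lower graph lies below the upper graph, hence below the
   lower graph by maximality of the envelope; iterating the shift contradicts
   boundedness. *)
Lemma shift_graph_lt r s z : r < s ->
  shift_graph orbit_inf r z < shift_graph lower_graph s z.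
Proof.
move=> rs.
have [[y lt_y]|nlt] := pselect (exists y,
    shift_graph orbit_inf r y < shift_graph lower_graph s y).
  apply: invariant_graph_lt lt_y z; try apply: shift_graph_invariant.
  - exact: orbit_inf_invariant.
  - exact: lower_graph_invariant.
  - exact/usc_shift_graph/usc_orbit_inf.
  - exact/lsc_shift_graph/lsc_lower_graph.
exfalso; pose d := s - r; have d0 : 0 < d by rewrite subr_gt0.
have drop y : lower_graph (phi d y) + d <= lower_graph y.
  apply: (lsc_minorant_le (g := shift_graph lower_graph d)); split.
    exact/lsc_shift_graph/lsc_lower_graph.
  (* Seen from [phi (- r) x], the shifts by [r] and [s] become shifts by [0] and [d] at [x]. *)
  move=> x; rewrite leNgt; apply/negP => lt_x; apply: nlt.
  exists (phi (- r) x); move: lt_x; rewrite /shift_graph -!phiD subrr phi0 /d.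
  lra.
have dropn n : lower_graph (phi (n%:R * d) z) + n%:R * d <= lower_graph z.
  elim: n => [|n]; first by rewrite mul0r phi0 addr0.
  have := drop (phi (n%:R * d) z); rewrite -phiD -[n.+1%:R]natr1 mulrDl mul1r.
  rewrite [d + _]addrC; lra.
(* The lower graph takes values in [[- C, C]], so it cannot drop by more than the length of this
   interval. *)
have [n Cn] : exists n : nat, C - - C < n%:R * d.
  exists (Num.bound `|(C - - C) / d|); rewrite -ltr_pdivrMr//.
  by apply: le_lt_trans (ler_norm _) _; exact: archi_boundP (normr_ge0 _).
have /andP[_ zC] := lower_graph_bounds z.
have /andP[Cz _] := lower_graph_bounds (phi (n%:R * d) z).
have := dropn n; lra.
Qed.

(** This makes each [solution_set x] below downward closed. *)
Lemma shift_lower_graph_le r s z : r <= s ->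
  shift_graph lower_graph r z <= shift_graph lower_graph s z.
Proof.
rewrite le_eqVlt => /predU1P[->//|rs].
apply/ltW; apply: le_lt_trans (shift_graph_lt z rs).
by rewrite lerD2r lower_graph_le.
Qed.

(** * The continuous solution of the cohomological equation *)

Definition solution_set x := [set r | shift_graph lower_graph r x <= 0].

Definition solution x := sup (solution_set x).

Lemma solution_set_neq0 x : solution_set x !=set0.
Proof.
exists (- C); rewrite /solution_set /shift_graph /=.
by have /andP[_] := lower_graph_bounds (phi (- C) x); lra.
Qed.

Lemma solution_set_ubound x : has_ubound (solution_set x).
Proof.
exists C => r; rewrite /solution_set /shift_graph /=.
by have /andP[+ _] := lower_graph_bounds (phi r x); lra.
Qed.

Lemma solution_continuous : continuous solution.
Proof.
move=> x; apply/cvgrPdist_le => e e0; near=> y; rewrite ler_distl.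
apply/andP; split; last first.
  (* To put [solution x - e] in [solution_set y], the lower graph is replaced by the upper one: its
     shift is strictly negative at [x], hence also nearby by upper semicontinuity. *)
  rewrite -lerBlDr; apply: ub_le_sup; first exact: solution_set_ubound.
  apply: (@le_trans _ _ (shift_graph orbit_inf (solution x - e) y)).
    by rewrite lerD2r lower_graph_le.
  apply: ltW; near: y; apply: usc_shift_graph; first exact: usc_orbit_inf.
  have [||r Sr rx] := @sup_gt _ (solution_set x) (solution x - e).
  - exact: solution_set_neq0.
  - by rewrite -/(solution x); lra.
  - exact: lt_le_trans (shift_graph_lt x rx) Sr.
rewrite lerBlDr; apply: ge_sup; first exact: solution_set_neq0.
move=> r Sr; rewrite leNgt; apply/negP => xr.
(* The shift by [solution x + e] is beyond the supremum, hence positive at [x], and lower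
   semicontinuity keeps it positive nearby. *)
have : 0 < shift_graph lower_graph (solution x + e) y.
  near: y; apply: lsc_shift_graph; first exact: lsc_lower_graph.
  rewrite ltNge; apply/negP => /(ub_le_sup (solution_set_ubound x)).
  by rewrite -/(solution x); lra.
rewrite ltNge => /negP; apply; apply: le_trans (shift_lower_graph_le y _) Sr.
exact: ltW.
Unshelve. all: by end_near. Qed.

(** Membership of [r] compares the lower graph over [phi r (Phi t x)] with height [- r]. With [r']
    the shift on the right, the skew product carries height [- r'] over [phi r' x] there, preserving
    order and the graph. *)
Lemma solution_set_flow x t r :
  solution_set (Phi t x) r <->
  solution_set x (r + tau t x - time_val t * rho).
Proof.
set r' := r + _ - _.
have PhiE : phi r (Phi t x) = Trho t (phi r' x).
  rewrite translation_flow_phi /leaf_flow /translation_flow -!phiD.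
  by congr phi; rewrite /r'; lra.
have rE : - r = fibre_map t (phi r' x) (- r').
  by rewrite /fibre_map -phiD addNr phi0 /r'; lra.
rewrite /solution_set /shift_graph /= PhiE lower_graph_invariant.
rewrite -[r in _ + r]opprK -[X in _ <-> _ + X <= 0]opprK !subr_le0.
by rewrite rE le_fibre_map.
Qed.

Lemma solution_cohomological :
  cohomological_solution phi omega tau rho solution.
Proof.
move=> x t; pose c := tau t x - time_val t * rho.
suff : solution (Phi t x) = solution x - c by rewrite /c; lra.
apply/le_anti/andP; split.
  apply: ge_sup => [|r /solution_set_flow]; first exact: solution_set_neq0.
  move=> /(ub_le_sup (solution_set_ubound x)).
  by rewrite -/(solution x) /c; lra.
rewrite lerBlDr; apply: ge_sup => [|r Sr]; first exact: solution_set_neq0.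
rewrite -lerBlDr; apply: ub_le_sup; first exact: solution_set_ubound.
by apply/solution_set_flow; rewrite -addrA -/c subrK.
Qed.

(** Since [phi (r - t) (phi t x)] is [phi r x], each [r] in [solution_set x] gives [r - t] in
    [solution_set (phi t x)]. *)
Lemma solution_order x (t : R) : 0 <= t -> solution x <= t + solution (phi t x).
Proof.
move=> t0; apply: ge_sup => [|r]; first exact: solution_set_neq0.
rewrite -lerBlDl /solution_set /shift_graph /= => Sr.
apply: ub_le_sup; first exact: solution_set_ubound.
by rewrite /solution_set /shift_graph /= -phiD subrK; lra.
Qed.

End bounded_mean_motion.
End leaf_flow_theory.

(** * Consequences of compactness, and the conclusion *)

Lemma continuous_image_dense_onto (X Y : topologicalType) (h : X -> Y) :
  hausdorff_space Y -> compact [set: X] -> continuous h -> dense (range h) ->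
  forall y, exists x, h x = y.
Proof.
move=> hY cX ch dh y.
have : closed (range h).
  apply: compact_closed => //; apply: continuous_compact => //.
  exact: continuous_subspaceT.
move=> clh; suff [x _ <-] : range h y by exists x.
apply: contrapT => nhy.
by have [z []] := dh (~` range h) (ex_intro _ y nhy) (closed_openC clh).
Qed.

Lemma compact_continuous_bounded (R : realType) (X : topologicalType)
    (f : X -> R) : compact [set: X] -> continuous f ->
  exists2 M : R, 0 < M & forall x, `|f x| <= M.
Proof.
move=> cX cf.
have /compact_bounded/ex_strict_bound_gt0[M M0 fM] : compact (f @` [set: X]).
  by apply: continuous_compact => //; exact: continuous_subspaceT.
by exists M => // x; apply/ltW/fM; exists x.
Qed.

Theorem theorem1p3 (R : realType) (k : time_kind) (Omega : metricType R)
    (phi : R -> Omega -> Omega) (omega : time R k -> Omega -> Omega)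
    (tau : time R k -> Omega -> R) (rho : R)
    (compact_Omega : compact [set: Omega])
    (flow_phi : is_flow phi)
    (flow_omega : is_flow omega)
    (phi_omega : commuting_flows phi omega)
    (tau_translation : translation_function phi omega tau)
    (order_Phi : preserves_leaf_order phi tau)
    (rho_Phi : translation_number tau rho)
    (rho_irrational : irrational_for phi omega rho) :
  [/\ (exists2 gamma : Omega -> R,
          continuous gamma & cohomological_solution phi omega tau rho gamma) <->
        bounded_mean_motion tau rho,
      forall gamma : Omega -> R,
        continuous gamma ->
        cohomological_solution phi omega tau rho gamma ->
        semiconjugacy (leaf_flow phi omega tau) (translation_flow phi omega rho)
          (fun x => phi (gamma x) x) &
      bounded_mean_motion tau rho ->
        exists gamma : Omega -> R,
          [/\ continuous gamma,
              cohomological_solution phi omega tau rho gamma &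
              forall x (t : R), 0 <= t -> gamma x <= t + gamma (phi t x)]].

Proof.
have exists_gamma : bounded_mean_motion tau rho -> exists gamma : Omega -> R,
    [/\ continuous gamma, cohomological_solution phi omega tau rho gamma &
        forall x (t : R), 0 <= t -> gamma x <= t + gamma (phi t x)].
  move=> [C _ tauC]; exists (solution phi omega tau rho); split.
  - exact: solution_continuous tauC _.
  - exact: solution_cohomological tauC.
  - exact: solution_order tauC.
split=> //.
- split=> [[gamma gamma_cont gammaE]|]; last first.
    by move=> /exists_gamma[gamma []]; exists gamma.
  have [M M0 gammaM] := compact_continuous_bounded compact_Omega gamma_cont.
  exists (M + M) => [|x t]; first exact: addr_gt0.
  by rewrite gammaE addrK (le_trans (ler_normB _ _)) // lerD.
- move=> gamma gamma_cont gammaE.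
  have h_cont : continuous (fun x => phi (gamma x) x).
    move=> x; apply: (@continuous_comp _ _ _ (fun y => (gamma y, y))
      (fun p => phi p.1 p.2)); last exact: phi_continuous.
    apply: (cvg_pair (G := nbhs (gamma x)) (H := nbhs x)); last exact: cvg_id.
    exact: gamma_cont.
  have h_semiconj := cohomological_semiconj flow_phi phi_omega gammaE.
  split=> // y.
  apply: continuous_image_dense_onto h_cont _ y => //.
    exact: metric_hausdorff.
  (* By the intertwining relation, the range contains the whole translation orbit of
     [phi (gamma z) z], which is dense by minimality. *)
  move=> U /[dup] U0 [z Uz] oU.
  have [w [Uw [t _ tw]]] := rho_irrational (phi (gamma z) z) U U0 oU.
  exists w; split=> //; exists (leaf_flow phi omega tau t z) => //.
  by rewrite h_semiconj.
Qed.
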